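(* Let $p$ be an integer, let $n$ and $r$ be non-negative integers, and let $q$ be an integer with $q+r\ge 0$. Then $$\sum_{k=0}^{n}\genfrac{[}{]}{0pt}{}{n+r}{k+r}_{r}B_{k}^{(p)}(q)=n!\,H_{n+1}^{(p,q+r)}.$$
   Context: For an integer $p$, the generalized hyperharmonic numbers are defined by $H_n^{(p,0)}=1/n^p$ for $n\ge 1$ and $H_{n}^{(p,s)}=\sum_{k=1}^{n}H_{k}^{(p,s-1)}$ for integers $s\ge 1$, $n\ge 1$. The $r$-Stirling numbers of the first kind $\genfrac{[}{]}{0pt}{}{n+r}{k+r}_{r}$ ($n,k,r\ge 0$) are defined by the polynomial identity $(x+r)(x+r+1)\cdots(x+r+n-1)=\sum_{k=0}^{n}\genfrac{[}{]}{0pt}{}{n+r}{k+r}_{r}x^{k}$. The poly-Bernoulli polynomials $B_n^{(p)}(x)$ are defined by $\sum_{n=0}^{\infty}B_{n}^{(p)}(x)\frac{t^{n}}{n!}=\frac{\mathrm{Li}_{p}(1-e^{-t})}{1-e^{-t}}e^{xt}$, where $\mathrm{Li}_p(t)=\sum_{n=1}^{\infty}t^n/n^p$ (as formal power series). *)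

(* Defs.v *)
From HB Require Import structures.
From mathcomp Require Import all_boot all_order all_algebra.

Set Implicit Arguments.
Unset Strict Implicit.
Unset Printing Implicit Defensive.

Import Order.TTheory GRing.Theory Num.Theory.
Local Open Scope ring_scope.

(* A formal power series is the sequence of its coefficients. *)
Definition fps (R : Type) : Type := nat -> R.

Definition fps_one (R : comUnitRingType) : fps R := fun n => (n == 0%N)%:R.

Definition fps_sub (R : comUnitRingType) (f g : fps R) : fps R :=
  fun n => f n - g n.

Definition fps_mul (R : comUnitRingType) (f g : fps R) : fps R :=
  fun n => \sum_(i < n.+1) f i * g (n - i)%N.

Definition fps_pow (R : comUnitRingType) (f : fps R) (k : nat) : fps R :=
  iter k (fps_mul f) (fps_one R).

(* The substitution f(g(t)), meaningful when g 0 = 0: then g^k has no term of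
   degree < k, so that only k <= n contributes to the coefficient of t^n. *)
Definition fps_comp (R : comUnitRingType) (f g : fps R) : fps R :=
  fun n => \sum_(k < n.+1) f k * fps_pow g k n.

(* The quotient f / g of two series without constant term, where g 1 is
   invertible, by long division; see fps_divP. The sequence fps_div_seq f g n
   lists the first n coefficients of the quotient. *)
Fixpoint fps_div_seq (R : comUnitRingType) (f g : fps R) (n : nat) : seq R :=
  if n is m.+1 then
    let s := fps_div_seq f g m in
    rcons s ((f m.+1 - \sum_(i < m) s`_i * g (m.+1 - i)%N) / g 1%N)
  else [::].

Definition fps_div (R : comUnitRingType) (f g : fps R) : fps R :=
  fun n => (fps_div_seq f g n.+1)`_n.

Lemma size_fps_div_seq (R : comUnitRingType) (f g : fps R) (n : nat) :
  size (fps_div_seq f g n) = n.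
Proof. by elim: n => //= n IHn; rewrite size_rcons IHn. Qed.

Lemma nth_fps_div_seq (R : comUnitRingType) (f g : fps R) (n i : nat) :
  (i < n)%N -> (fps_div_seq f g n)`_i = fps_div f g i.
Proof.
elim: n => // n IHn; rewrite ltnS leq_eqVlt => /predU1P[-> // | lt_in].
by rewrite /= nth_rcons size_fps_div_seq lt_in IHn.
Qed.

Lemma fps_divP (R : comUnitRingType) (f g : fps R) :
    f 0%N = 0 -> g 0%N = 0 -> g 1%N \is a GRing.unit ->
  fps_mul (fps_div f g) g =1 f.
Proof.
move=> f0 g0 g1 [|n]; first by rewrite /fps_mul big_ord1 subnn g0 mulr0 f0.
rewrite /fps_mul big_ord_recr /= subnn g0 mulr0 addr0 big_ord_recr /= subSnn.
rewrite {2}/fps_div /= nth_rcons size_fps_div_seq ltnn eqxx divrK //.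
under [X in _ - X]eq_bigr => i _ do rewrite nth_fps_div_seq //.
by rewrite addrC subrK.
Qed.

(* The series e^(a t), where a is a polynomial in the indeterminate x = 'X. *)
Definition fps_exp (a : {poly rat}) : fps {poly rat} :=
  fun n => (n`!%:R)^-1 *: a ^+ n.

Definition fps_polylog (p : int) : fps {poly rat} :=
  fun n => if n == 0%N then 0 else ((n%:R ^ p)^-1)%:P.

Definition one_sub_exp_neg : fps {poly rat} :=
  fps_sub (fps_one {poly rat}) (fps_exp (- 1)).

Definition poly_bernoulli_gf (p : int) : fps {poly rat} :=
  fps_mul (fps_div (fps_comp (fps_polylog p) one_sub_exp_neg) one_sub_exp_neg)
    (fps_exp 'X).

Definition poly_bernoulli (p : int) (n : nat) : {poly rat} :=
  n`!%:R *: poly_bernoulli_gf p n.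

(* The side conditions of fps_comp and fps_divP hold in poly_bernoulli_gf. *)
Lemma one_sub_exp_neg0 : one_sub_exp_neg 0 = 0.
Proof. by rewrite /one_sub_exp_neg /fps_sub /fps_exp invr1 scale1r subrr. Qed.

Lemma one_sub_exp_neg1 : one_sub_exp_neg 1 = 1.
Proof.
by rewrite /one_sub_exp_neg /fps_sub /fps_exp invr1 scale1r expr1 sub0r opprK.
Qed.

Lemma fps_comp_polylog0 (p : int) (g : fps {poly rat}) :
  fps_comp (fps_polylog p) g 0 = 0.
Proof. by rewrite /fps_comp big_ord1 mul0r. Qed.

(* rstirling1 r n k is the r-Stirling number of the first kind with upper entry
   n + r and lower entry k + r: both entries are shifted by r. *)
Definition rstirling1 (r n k : nat) : rat :=
  (\prod_(i < n) ('X + (r + i)%:R%:P))`_k.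

(* hyperharmonic p s n is H_n^(p,s); its value at n = 0 is irrelevant. *)
Fixpoint hyperharmonic (p : int) (s n : nat) : rat :=
  if s is s'.+1 then \sum_(1 <= k < n.+1) hyperharmonic p s' k
  else (n%:R ^ p)^-1.

(* Main.v *)
Require Import Defs.
From mathcomp Require Import all_boot all_order all_algebra.
From mathcomp Require Import ring.

(* Put u = 1 - e^(-t), so that the generating function of the B_k^(p)(x) is
   \sum_m (m+1)^(-p) u^m e^(x t).  The map F |-> \sum_k [n+r, k+r]_r k! F_k
   sends e^(a t) to the rising factorial (a+r)(a+r+1)...(a+r+n-1).  Since
   u e^(a t) = e^(a t) - e^((a-1) t), a factor u acts on the image as a backward
   difference in a, hence u^m e^(a t) is sent to
   n(n-1)...(n-m+1) (a+r)...(a+r+n-m-1).  At a = q this is n! times the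
   coefficient of (m+1)^(-p) in H_(n+1)^(p,q+r). *)

Set Implicit Arguments.
Unset Strict Implicit.
Unset Printing Implicit Defensive.

Import Order.TTheory GRing.Theory Num.Theory.
Local Open Scope ring_scope.

Section FormalPowerSeries.
Variable R : comUnitRingType.
Implicit Types f g h : fps R.

Lemma eq_fps_mul f1 f2 g1 g2 :
  f1 =1 f2 -> g1 =1 g2 -> fps_mul f1 g1 =1 fps_mul f2 g2.
Proof. by move=> ef eg n; apply: eq_bigr => i _; rewrite ef eg. Qed.

(** Truncation to polynomials: commutativity and associativity of the Cauchy product are inherited
    from [{poly R}]. *)
Lemma fps_mul_coef_poly f g (N n : nat) : (n < N)%N ->
  fps_mul f g n = (\poly_(i < N) f i * \poly_(i < N) g i)`_n.
Proof.
move=> lt_nN; rewrite coefM; apply: eq_bigr => i _; rewrite !coef_poly.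
by rewrite (leq_ltn_trans (leq_ord i) lt_nN) (leq_ltn_trans (leq_subr i n) lt_nN).
Qed.

Lemma fps_mulC f g : fps_mul f g =1 fps_mul g f.
Proof. by move=> n; rewrite !(@fps_mul_coef_poly _ _ n.+1) // mulrC. Qed.

Lemma fps_mulA f g h : fps_mul f (fps_mul g h) =1 fps_mul (fps_mul f g) h.
Proof.
move=> n; transitivity (\poly_(i < n.+1) f i *
    (\poly_(i < n.+1) g i * \poly_(i < n.+1) h i))`_n.
  rewrite coefM; apply: eq_bigr => i _.
  by rewrite coef_poly ltn_ord (@fps_mul_coef_poly _ _ n.+1) // ltnS leq_subr.
rewrite mulrA coefM; apply: eq_bigr => i _.
by rewrite coef_poly ltnS leq_subr (@fps_mul_coef_poly _ _ n.+1).
Qed.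

Lemma fps_mul1 f : fps_mul (fps_one R) f =1 f.
Proof.
move=> n; rewrite /fps_mul big_ord_recl /= subn0 mul1r big1 ?addr0 // => i _.
by rewrite /fps_one mul0r.
Qed.

Lemma fps_mulBl f g h :
  fps_mul (fps_sub f g) h =1 fps_sub (fps_mul f h) (fps_mul g h).
Proof.
by move=> n; rewrite /fps_sub -sumrB; apply: eq_bigr => i _; rewrite mulrBl.
Qed.

Lemma fps_mulBr f g h :
  fps_mul f (fps_sub g h) =1 fps_sub (fps_mul f g) (fps_mul f h).
Proof.
by move=> n; rewrite /fps_sub -sumrB; apply: eq_bigr => i _; rewrite mulrBr.
Qed.

Lemma fps_pow_coef0 g (m n : nat) : g 0%N = 0 -> (n < m)%N -> fps_pow g m n = 0.
Proof.
move=> g0; elim: m n => // m IHm n lt_nm.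
rewrite /= /fps_mul big_ord_recl g0 mul0r add0r big1 // => i _.
rewrite IHm ?mulr0 // lift0; have := ltn_ord i.
by case: n lt_nm i => // n lt_nm i _; rewrite subSS (leq_ltn_trans (leq_subr _ _)).
Qed.

(** The added terms vanish by [fps_pow_coef0]. A bound [N] that does not depend on [n] is what
    allows sums to be exchanged later. *)
Lemma fps_compE f g (N n : nat) : g 0%N = 0 -> (n < N)%N ->
  fps_comp f g n = \sum_(m < N) f m * fps_pow g m n.
Proof.
move=> g0 lt_nN; rewrite /fps_comp.
rewrite (big_ord_widen N (fun m => f m * fps_pow g m n)) //.
rewrite big_mkcond; apply: eq_bigr => m _.
by case: ltnP => // lt_nm; rewrite fps_pow_coef0 ?mulr0.
Qed.

Lemma fps_comp_mulE f g h (N n : nat) : g 0%N = 0 -> (n < N)%N ->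
  fps_mul (fps_comp f g) h n = \sum_(m < N) f m * fps_mul (fps_pow g m) h n.
Proof.
move=> g0 lt_nN.
under [RHS]eq_bigr => m _ do rewrite mulr_sumr.
rewrite exchange_big; apply: eq_bigr => i _ /=.
rewrite (@fps_compE _ _ N) ?(leq_ltn_trans (leq_ord i)) // mulr_suml.
by apply: eq_bigr => m _; rewrite mulrA.
Qed.

Lemma fps_mul_comp_shift f g : f 0%N = 0 -> g 0%N = 0 ->
  fps_mul (fps_comp (fun m => f m.+1) g) g =1 fps_comp f g.
Proof.
move=> f0 g0 n; rewrite (@fps_comp_mulE _ _ _ n.+1) //.
rewrite (@fps_compE _ _ n.+2) // [RHS]big_ord_recl f0 mul0r add0r.
by apply: eq_bigr => m _; rewrite fps_mulC.
Qed.

(** Since [g] has order exactly 1, coefficient [n.+1] of the product involves only the first factor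
    up to index [n], with [g 1] multiplying the entry at [n]; strong induction applies. *)
Lemma fps_mulIf f1 f2 g : g 0%N = 0 -> g 1%N \is a GRing.unit ->
  fps_mul f1 g =1 fps_mul f2 g -> f1 =1 f2.
Proof.
move=> g0 g1 e12; elim/ltn_ind => n IHn.
have:= e12 n.+1; rewrite /fps_mul !(big_ord_recr n.+1) !(big_ord_recr n) /=.
rewrite subnn g0 !mulr0 !addr0 subSnn.
under eq_bigr => i _ do rewrite IHn //.
by move/addrI/(mulIr g1).
Qed.

(** Both sides times [g] give [f(g(t))], so cancelling [g] replaces the long division by a shift of
    coefficients. *)
Lemma fps_div_comp f g : f 0%N = 0 -> g 0%N = 0 -> g 1%N \is a GRing.unit ->
  fps_div (fps_comp f g) g =1 fps_comp (fun m => f m.+1) g.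
Proof.
move=> f0 g0 g1; apply: (fps_mulIf g0 g1) => n.
by rewrite fps_mul_comp_shift // fps_divP // /fps_comp big_ord1 f0 mul0r.
Qed.

End FormalPowerSeries.

Lemma fps_expD (a b : {poly rat}) :
  fps_mul (fps_exp a) (fps_exp b) =1 fps_exp (a + b).
Proof.
move=> n; rewrite /fps_exp addrC exprDn scaler_sumr; apply: eq_bigr => i _.
rewrite -scalerAl -scalerAr scalerA [a ^+ i * _]mulrC -scaler_nat scalerA.
congr (_ *: _); have le_in := leq_ord i.
have factN0 (k : nat) : k`!%:R != 0 :> rat by rewrite pnatr_eq0 -lt0n fact_gt0.
rewrite -(bin_fact le_in) !natrM; field.
by rewrite !factN0 pnatr_eq0 -lt0n bin_gt0.
Qed.

Lemma fps_pow_one_sub_exp_negS (m : nat) (a : {poly rat}) :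
  fps_mul (fps_pow one_sub_exp_neg m.+1) (fps_exp a) =1
  fps_sub (fps_mul (fps_pow one_sub_exp_neg m) (fps_exp a))
          (fps_mul (fps_pow one_sub_exp_neg m) (fps_exp (a - 1))).
Proof.
move=> n; rewrite -fps_mulBr /=.
rewrite (eq_fps_mul (fps_mulC _ _) (frefl _)) -fps_mulA.
apply: eq_fps_mul => // k; rewrite fps_mulBl /fps_sub fps_mul1 fps_expD.
by rewrite [- 1 + a]addrC.
Qed.

(** The factor [k!] turns an ordinary coefficient into one of an exponential generating function. *)
Definition stirling_transform (r n : nat) (f : fps {poly rat}) : {poly rat} :=
  \sum_(k < n.+1) (rstirling1 r n k * k`!%:R) *: f k.

Definition rising (R : nzRingType) (a : R) (n : nat) : R :=
  \prod_(i < n) (a + i%:R).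

(** For [n > 0] both products contain [a (a+1) ... (a+n-2)]; the remaining factors [a+n-1] and [a-1]
    differ by [n]. *)
Lemma rising_subr1 (R : comNzRingType) (a : R) (n : nat) :
  rising a n - rising (a - 1) n = n%:R * rising a n.-1.
Proof.
case: n => [|n]; first by rewrite /rising !big_ord0 subrr mul0r.
rewrite /rising big_ord_recr [X in _ - X]big_ord_recl /= addr0.
have -> : \prod_(i < n) (a - 1 + (lift ord0 i)%:R) = \prod_(i < n) (a + i%:R).
  by apply: eq_bigr => i _; rewrite lift0 -natr1; ring.
by rewrite -natr1; ring.
Qed.

Lemma stirling_transform_exp (r n : nat) (a : {poly rat}) :
  stirling_transform r n (fps_exp a) = rising (a + r%:R) n.
Proof.
set P : {poly rat} := \prod_(i < n) ('X + (r + i)%:R%:P).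
(* This bound lets the sum over [size P] in [comp_polyE] be extended to [n.+1] terms. *)
have sizeP : (size P <= n.+1)%N.
  rewrite /P; under eq_bigr => i _ do rewrite -[_%:P]opprK -polyCN.
  by rewrite size_prod_XsubC /index_enum -enumT size_enum_ord.
have -> : rising (a + r%:R) n = P \Po a.
  rewrite /P rmorph_prod; apply: eq_bigr => i _.
  by rewrite /= comp_polyD comp_polyX comp_polyC polyCMn natrD addrA.
rewrite comp_polyE (big_ord_widen n.+1 (fun i => P`_i *: a ^+ i)) //.
rewrite big_mkcond; apply: eq_bigr => k _.
rewrite /fps_exp scalerA mulfK ?pnatr_eq0 -?lt0n ?fact_gt0 //.
by case: ltnP => // le_Pk; rewrite /rstirling1 nth_default ?scale0r.
Qed.

(** Induction on [m] for all [a] at once, as the step also uses [a - 1]. For [m > n] the falling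
    factorial is 0, so the truncated [n - m] is harmless. *)
Lemma stirling_transform_pow_exp (r n m : nat) (a : {poly rat}) :
  stirling_transform r n (fps_mul (fps_pow one_sub_exp_neg m) (fps_exp a))
  = (n ^_ m)%:R * rising (a + r%:R) (n - m).
Proof.
elim: m a => [|m IHm] a.
  rewrite ffactn0 mul1r subn0 -stirling_transform_exp.
  by apply: eq_bigr => k _; rewrite fps_mul1.
rewrite /stirling_transform.
under eq_bigr => k _ do rewrite fps_pow_one_sub_exp_negS scalerBr.
rewrite sumrB -/(stirling_transform _ _ _) IHm.
rewrite -/(stirling_transform r n (fps_mul _ (fps_exp (a - 1)))) IHm -mulrBr.
by rewrite addrAC rising_subr1 mulrA -natrM ffactnSr subnS.
Qed.

Lemma poly_bernoulli_gfE (p : int) (N k : nat) : (k < N)%N ->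
  poly_bernoulli_gf p k = \sum_(m < N) (m.+1%:R ^ p)^-1 *:
    fps_mul (fps_pow one_sub_exp_neg m) (fps_exp 'X) k.
Proof.
move=> lt_kN; have u0 := one_sub_exp_neg0.
have u1 : one_sub_exp_neg 1 \is a GRing.unit by rewrite one_sub_exp_neg1 unitr1.
rewrite /poly_bernoulli_gf (eq_fps_mul (fps_div_comp _ u0 u1) (frefl _)) //.
rewrite (@fps_comp_mulE _ _ _ _ N) //.
by apply: eq_bigr => m _; rewrite /fps_polylog /= mul_polyC.
Qed.

Lemma stirling_sum_poly_bernoulli (p : int) (n r : nat) :
  \sum_(k < n.+1) rstirling1 r n k *: poly_bernoulli p k
  = \sum_(m < n.+1) ((m.+1%:R ^ p)^-1 * (n ^_ m)%:R)
      *: rising ('X + r%:R) (n - m).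
Proof.
under [RHS]eq_bigr => m _ do
  rewrite -scalerA scaler_nat -[_ *+ n ^_ m]mulr_natl
    -stirling_transform_pow_exp scaler_sumr.
rewrite exchange_big; apply: eq_bigr => k _ /=.
rewrite /poly_bernoulli (@poly_bernoulli_gfE _ n.+1) // scalerA scaler_sumr.
by apply: eq_bigr => m _; rewrite !scalerA mulrC.
Qed.

(** Pascal's rule: [rising s k / k!] is the number of multisets of size [k] from [s] elements. *)
Lemma rising_fact_recr (s k : nat) :
  rising (s.+1%:R : rat) k.+1 / k.+1`!%:R
  = rising s.+1%:R k / k`!%:R + rising s%:R k.+1 / k.+1`!%:R.
Proof.
have := rising_subr1 (s.+1%:R : rat) k.+1; rewrite -{2}natr1 addrK /=.
move/(canRL (subrK _)) => ->; rewrite mulrDl factS natrM; congr (_ + _).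
by rewrite -mulf_div divff ?mul1r ?pnatr_eq0.
Qed.

Lemma hyperharmonicE (p : int) (s n : nat) :
  hyperharmonic p s n.+1
  = \sum_(m < n.+1) (m.+1%:R ^ p)^-1 * (rising s%:R (n - m) / (n - m)`!%:R).
Proof.
elim: s n => [|s IHs] n.
  rewrite big_ord_recr subnn /rising /= big_ord0 fact0 mul1r invr1 mulr1.
  (* For [m < n] the rising factorial of 0 has a factor 0, so only the term [m = n] survives. *)
  rewrite big1 ?add0r // => m _; rewrite -(subnSK (ltn_ord m)) big_ord_recl.
  by rewrite addr0 !mul0r mulr0.
elim: n => [|n IHn].
  by rewrite /= big_nat1 IHs !big_ord1 subnn /rising !big_ord0.
rewrite /= big_nat_recr //= -/(hyperharmonic p s.+1 n.+1) IHn IHs.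
(* The terms at [m = n.+1] carry empty products and agree; the others match by Pascal's rule. *)
rewrite [X in _ + X = _]big_ord_recr [RHS]big_ord_recr /= addrA.
rewrite subnn /rising !big_ord0.
congr (_ + _); rewrite -big_split; apply: eq_bigr => m _ /=.
by rewrite -mulrDr subSn ?leq_ord // -!/(rising _ _) rising_fact_recr.
Qed.

Theorem theorem1 (p : int) (n r : nat) (q : int) (hqr : 0 <= q + r%:Z) :
  \sum_(k < n.+1) rstirling1 r n k * (poly_bernoulli p k).[q%:~R]
  = n`!%:R * hyperharmonic p `|(q + r%:Z)%R|%N n.+1.
Proof.
under eq_bigr => k _ do rewrite -hornerZ.
rewrite -horner_sum stirling_sum_poly_bernoulli horner_sum hyperharmonicE.
rewrite mulr_sumr; apply: eq_bigr => m _.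
(* Here [hqr] enters: the order of the hyperharmonic number is the value of ['X + r%:R] at [q]. *)
have -> : `|(q + r%:Z)%R|%N%:R = q%:~R + r%:R :> rat.
  by rewrite pmulrn gez0_abs // rmorphD.
rewrite hornerZ /rising horner_prod.
under eq_bigr => i _ do
  rewrite !hornerD hornerX -!polyC_natr !hornerC.
rewrite -(ffact_fact (leq_ord m)) natrM; field.
by rewrite pnatr_eq0 -lt0n fact_gt0 expfz_neq0 ?pnatr_eq0.
Qed.
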